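(* Suppose that the randomized forward map $\mathcal G_h$ has mean-square order of convergence $s>0$ with respect to the prior $\mu_0$, and that the boundedness assumption (i)--(iv) stated in the context holds. Let $\mu_{h,\mathrm m}$ be the marginal posterior and $\mu_{h,\mathrm m}^M$ its Monte Carlo approximation. Then there is a constant $C>0$ independent of $h$ and $M$ such that $$\sqrt{\mathbb E^{\nu_h}\left[d_{\mathrm H}\left(\mu_{h,\mathrm m},\mu_{h,\mathrm m}^M\right)^2\right]}\le C\,\frac{h^s}{\sqrt M}.$$
   Context: Setting. $X$ and $Y$ are Banach spaces with their Borel $\sigma$-algebras, $\dim Y<\infty$; $\mathcal G\colon X\to Y$ is a (measurable) forward map; $y\in Y$ is a fixed observation; $\Gamma$ is a non-singular covariance on $Y$; $\mu_0=\mathcal N(m_0,C_0)$ is a Gaussian prior on $X$ with $m_0 \in X$ and trace-class covariance operator $C_0$. For each $h>0$, $\mathcal G_h\colon\Omega\times X\to Y$ is a random (measurable) forward map, where $(\Omega,\mathcal A)$ is a measurable space, $\nu_h$ is a probability measure on $\Omega$ giving the distribution of the first argument of $\mathcal G_h$, and the randomness of the two arguments is independent. $\mathbb E^{\nu_h}$ and $\mathbb E^{\mu_0}$ denote expectation with respect to $\nu_h$ and $\mu_0$. Set $$\Phi(u)=\tfrac12\|\Gamma^{-1/2}(y-\mathcal G(u))\|_Y^2,\quad Z=\int_X e^{-\Phi(u)}\,d\mu_0(u),\quad \Phi_h(\omega,u)=\tfrac12\|\Gamma^{-1/2}(y-\mathcal G_h(\omega,u))\|_Y^2,\quad Z_h(\omega)=\int_X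 e^{-\Phi_h(\omega,u)}\,d\mu_0(u).$$ The dependence on $\omega$ is usually omitted. Mean-square order. $\mathcal G_h$ has mean-square order of convergence $s>0$ with respect to $\mu_0$ if there is a constant $C>0$ independent of $h$ such that $\mathbb E^{\nu_h}\left[\|\mathcal G(u)-\mathcal G_h(\cdot,u)\|_Y^2\right]^{1/2}\le Ch^s$, $\mu_0$-a.s. in $u$. Monte Carlo quantities. For a positive integer $M$, let $\Phi_h^{(1)},\dots,\Phi_h^{(M)}$ be i.i.d. copies of the random function $\Phi_h$ (i.e. $\Phi_h^{(i)}(u)=\Phi_h(\omega_i,u)$ with $\omega_i$ i.i.d. of law $\nu_h$), and set $\exp^M(\pm\Phi_h(u))=\frac1M\sum_{i=1}^M\exp(\pm\Phi_h^{(i)}(u))$, $Z_h^{(i)}=\int_X\exp(-\Phi_h^{(i)}(u))\,d\mu_0(u)$, $Z_h^M=\frac1M\sum_{i=1}^M Z_h^{(i)}$. By abuse of notation, $\mathbb E^{\nu_h}$ also denotes expectation over the sample draws, and ''$\nu_h$-a.s.'' also means almost surely with respect to these draws. Measures. The marginal posterior $\mu_{h,\mathrm m}$ and its (random) Monte Carlo approximation $\mu_{h,\mathrm m}^M$ are defined by $$\frac{d\mu_{h,\mathrm m}}{d\mu_0}(u)=\frac{\mathbb E^{\nu_h}[\exp(-\Phi_h(u))]}{\mathbb E^{\nu_h}[Z_h]},\qquad \frac{d\mu_{h,\mathrm m}^M}{d\mu_0}(u)=\frac{\exp^M(-\Phi_h(u))}{Z_h^M}.$$ Hellinger distance: for $\mu,\nu$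 absolutely continuous with respect to a reference probability measure $\lambda$, $d_{\mathrm H}(\mu,\nu)^2=\frac12\int_X\left(\sqrt{d\mu/d\lambda}-\sqrt{d\nu/d\lambda}\right)^2d\lambda$. Boundedness assumption. There are constants $C_1,\dots,C_4>0$ independent of $h$ and $M$ such that: (i) $\min\left\{\mathbb E^{\nu_h}\left[\|\exp(\Phi_h)\|_{L^\infty_{\mu_0}(X)}\right],\ \|\exp^M(\Phi_h)\|_{L^\infty_{\mu_0}(X)}\right\}\le C_1$, $\nu_h$-a.s.; (ii) $C_2^{-1}\le Z\le C_2$; (iii) $C_3^{-1}\le Z_h\le C_3$, $\nu_h$-a.s.; (iv) $C_4^{-1}\le Z_h^M\le C_4$, $\nu_h$-a.s. *)

(* Defs.v *)
From HB Require Import structures.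
From mathcomp Require Import all_boot all_order all_algebra sesquilinear.
From mathcomp Require Import all_classical all_reals all_analysis.

Set Implicit Arguments.
Unset Strict Implicit.
Unset Printing Implicit Defensive.

Import Order.TTheory GRing.Theory Num.Theory.
Import numFieldNormedType.Exports.

Local Open Scope classical_set_scope.
Local Open Scope ring_scope.

Notation borel T := (g_sigma_algebraType (@open T)).

Definition finite_dim (R : realType) (V : lmodType R) : Prop :=
  exists (n : nat) (e : 'I_n -> V),
    forall v, exists c : 'I_n -> R, v = \sum_i c i *: e i.

(** Covariances on Y and their inverse square roots.  As an endomorphism of Y, a
    covariance is self-adjoint for an inner product on Y (for Y = R^n, the
    Euclidean one, which identifies covariance matrices with operators); this
    inner product is unrelated to the norm of Y. *)

Section covariance_Y.
Context (R : realType) (V : lmodType R) (ip : {dot V for (@idfun R)}).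

Definition covariance_endo (A : {linear V -> V}) : Prop :=
  (forall u v, ip (A u) v = ip u (A v)) /\ (forall v, 0 <= ip (A v) v).

Definition is_inv_sqrt (A : {linear V -> V}) (B : V -> V) : Prop :=
  exists S : {linear V -> V},
    [/\ covariance_endo S, forall v, S (S v) = A v, cancel S B & cancel B S].

End covariance_Y.

(** Gaussian measures on a Banach space X.  Covariance operators map the
    topological dual of X to X; they are represented by functions on all of
    [X -> R], of which only the values on the dual matter. *)

Section gaussian.
Context (R : realType) (X : completeNormedModType R).

Definition in_dual (l : X -> R) : Prop :=
  (forall a u v, l (a *: u + v) = a * l u + l v) /\ continuous l.

Definition dual_linear (V : lmodType R) (T : (X -> R) -> V) : Prop :=
  forall a l k, in_dual l -> in_dual k ->
    T (fun u => a * l u + k u) = a *: T l + T k.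

(** The norm of [F] as an element of the bidual of X is at most [c]. *)
Definition bidual_le (F : (X -> R) -> R) (c : R) : Prop :=
  dual_linear (F : (X -> R) -> R^o) /\
  forall l b, in_dual l -> (forall u, `|l u| <= b * `|u|) -> `|F l| <= c * b.

(** Trace class in the Banach space sense (nuclear): [T = sum_k F_k (.) x_k]
    with [sum_k ||F_k|| ||x_k|| < oo].  On Hilbert spaces these are the usual
    trace-class operators. *)
Definition trace_class (T : (X -> R) -> X) : Prop :=
  exists (F : nat -> (X -> R) -> R) (x : nat -> X) (c : nat -> R),
    [/\ forall k, bidual_le (F k) (c k),
        cvgn (series (fun k => c k * `|x k|)) &
        forall l, in_dual l -> series (fun k => F k l *: x k) @ \oo --> T l].

Definition covariance_operator (C : (X -> R) -> X) : Prop :=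
  [/\ dual_linear C,
      forall l k, in_dual l -> in_dual k -> l (C k) = k (C l) &
      forall l, in_dual l -> 0 <= l (C l)].

(** The law N(m, v) on R, parametrized by its variance, with N(m, 0) = dirac. *)
Definition normal_law (m v : R) (A : set R) : \bar R :=
  if v == 0 then \d_m A else normal_prob m (Num.sqrt v) A.

Definition gaussian_measure (m : X) (C : (X -> R) -> X)
    (mu : probability (borel X) R) : Prop :=
  forall l, in_dual l -> forall A : set R, measurable A ->
    mu (l @^-1` A) = normal_law (l m) (l (C l)) A.

End gaussian.

Section sampling.
Context (R : realType) (d d' : measure_display).
Context (S : measurableType d) (Omega : measurableType d').

Definition iid_sample (P : probability S R) (nu : probability Omega R) (M : nat)
    (xi : 'I_M -> {mfun S >-> Omega}) : Prop :=
  (forall i A, measurable A -> P (xi i @^-1` A) = nu A) /\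
  (forall (J : {set 'I_M}) (A : 'I_M -> set Omega),
    (forall i, measurable (A i)) ->
    P (\bigcap_(i in [set` J]) xi i @^-1` A i) =
    (\prod_(i in J) P (xi i @^-1` A i))%E).

End sampling.

(** [misfit Gamma^(-1/2) y (G u)] is the potential Phi(u). *)
Definition misfit (R : realType) (Y : normedModType R) (B : Y -> Y) (y z : Y) : R :=
  2^-1 * `|B (y - z)| ^+ 2.

(** Below, [Phi] is a potential X -> R, a random potential Omega -> X -> R, or
    the M sampled potentials 'I_M -> X -> R, as indicated by its type.  The
    [Rintegral]s only involve functions with values in [0, 1]. *)

Section posteriors.
Context (R : realType) (d d' : measure_display).
Context (X : measurableType d) (mu0 : probability X R).
Context (Omega : measurableType d') (nu : probability Omega R).

Definition normalizer (Phi : X -> R) : R := \int[mu0]_u expR (- Phi u).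

Definition marginal_density (Phi : Omega -> X -> R) (u : X) : R :=
  (\int[nu]_w expR (- Phi w u)) / (\int[nu]_w normalizer (Phi w)).

(** [exp_mc t] is exp^M at the M values [t i] (with their signs). *)
Definition exp_mc (M : nat) (t : 'I_M -> R) : R :=
  M%:R^-1 * \sum_(i < M) expR (t i).

Definition normalizer_mc (M : nat) (Phi : 'I_M -> X -> R) : R :=
  M%:R^-1 * \sum_(i < M) normalizer (Phi i).

Definition mc_density (M : nat) (Phi : 'I_M -> X -> R) (u : X) : R :=
  exp_mc (fun i => - Phi i u) / normalizer_mc Phi.

Definition has_density (mu : probability X R) (f : X -> R) : Prop :=
  forall A, measurable A -> mu A = (\int[mu0]_(u in A) (f u)%:E)%E.

(** Meaningful when [mu] and [mu'] are absolutely continuous with respect to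
    [mu0], where the Radon-Nikodym derivatives are finite everywhere. *)
Definition hellinger (mu mu' : probability X R) : \bar R :=
  ((2^-1)%:E * \int[mu0]_u
    ((Num.sqrt (fine (Radon_Nikodym (charge_of_finite_measure mu) mu0 u)) -
      Num.sqrt (fine (Radon_Nikodym (charge_of_finite_measure mu') mu0 u))) ^+ 2)%:E)%E
  `^ (2^-1).

End posteriors.

Section assumptions.
Context (R : realType) (d d' : measure_display).
Context (X : measurableType d) (mu0 : probability X R).
Context (Omega : measurableType d') (nu : R -> probability Omega R).

Definition mean_square_order (Y : normedModType R) (G : X -> Y)
    (Gh : R -> Omega * X -> Y) (s : R) : Prop :=
  exists2 C : R, 0 < C &
    forall h, 0 < h -> {ae mu0, forall u,
      ((\int[nu h]_w (`|G u - Gh h (w, u)| ^+ 2)%:E) `^ (2^-1)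
        <= (C * h `^ s)%:E)%E}.

Context (dS : R -> nat -> measure_display).
Context (S : forall h M, measurableType (dS h M)).
Context (P : forall h M, probability (S h M) R).
Context (xi : forall h M, 'I_M -> {mfun S h M >-> Omega}).

Definition boundedness (Phi : X -> R) (Phih : R -> Omega -> X -> R) : Prop :=
  exists C1 C2 C3 C4 : R, [/\ 0 < C1, 0 < C2, 0 < C3 & 0 < C4] /\
  [/\ forall h M, 0 < h -> (0 < M)%N -> {ae P h M, forall w,
        (Order.min
           (\int[nu h]_z 'N[mu0]_(+oo)[(fun u => (expR (Phih h z u))%:E)])
           ('N[mu0]_(+oo)[(fun u =>
              (exp_mc (fun i : 'I_M => Phih h (xi h i w) u))%:E)])
         <= C1%:E)%E},
      C2^-1 <= normalizer mu0 Phi <= C2,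
      forall h, 0 < h -> {ae nu h, forall z,
        C3^-1 <= normalizer mu0 (Phih h z) <= C3} &
      forall h M, 0 < h -> (0 < M)%N -> {ae P h M, forall w,
        C4^-1 <= normalizer_mc mu0 (fun i : 'I_M => Phih h (xi h i w)) <= C4}].

End assumptions.

(* Main.v *)
Require Import Defs.
From HB Require Import structures.
From mathcomp Require Import all_boot all_order all_algebra sesquilinear.
From mathcomp Require Import all_classical all_reals all_analysis.
From mathcomp Require Import measurable_realfun ess_sup_inf ring lra.

(** Write a = E[exp(-Phi_h)] and b = exp^M(-Phi_h) for the unnormalized
    densities of the two measures; b is the mean of M i.i.d. copies of a random
    function with expectation a.  Both take values in [0, 1].

    Hellinger distance versus mean square.  The normalizing constants are the
    integrals of a and b, so replacing one by the other costs no more than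
    replacing a by b, and the squared distance is at most
    K * int (a - b)^2 dmu0 as soon as a or b is bounded below almost everywhere:
    sqrt a - sqrt b = (a - b) / (sqrt a + sqrt b).  This is
    [hellinger_normalized_le].

    The lower bound.  The boundedness assumption controls means of exp(Phi_h),
    that is, of the inverses of the random variables whose means are a and b.  By
    convexity of the inverse, the mean of the inverses is at least the inverse of
    the mean, so one of a, b is bounded below.  Convexity is used only through the
    tangent lines 2 t - t^2 k <= 1 / k ([inv_tangent]), which keeps every
    integrand bounded.

    The rate.  For fixed u, E[(a - b)^2] is the variance of a mean of M i.i.d.
    variables, hence 1/M times the variance of exp(-Phi_h(u)); a variance is at
    most the mean square distance to any constant, and the constant
    exp(-Phi(u)) gives E[(exp(-Phi_h(u)) - exp(-Phi(u)))^2] / M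
    ([iid_mean_sqr_error]).  Since exp(-t^2/2) is Lipschitz and Gamma^(-1/2) is
    bounded because Y has finite dimension, this is at most a constant times
    E[|G(u) - G_h(u)|^2] / M, of order h^(2s) / M.  Integrating over u and
    exchanging the integrals over u and the sample concludes. *)

Import Order.TTheory GRing.Theory Num.Theory.
Import numFieldNormedType.Exports.
Local Open Scope classical_set_scope.
Local Open Scope ring_scope.

Set Implicit Arguments.
Unset Strict Implicit.
Unset Printing Implicit Defensive.

(** * The likelihood as a Lipschitz function of the forward map *)

(** For a <= b, p = a^2/2 and q = b^2/2, the difference is at most e^(-p) (q - p), and
    e^(-p) (1 + p) <= 1.  When b - a <= 1, a + b is at most 2a + 1, hence at most
    2 (1 + p); when b - a >= 1 the claim is trivial. *)
Lemma expR_half_sqr_lip (R : realType) (a b : R) : 0 <= a -> 0 <= b ->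
  `|expR (- (2^-1 * a ^+ 2)) - expR (- (2^-1 * b ^+ 2))| <= `|a - b|.
Proof.
wlog ab : a b / a <= b => [hwlog a0 b0|a0 b0].
  have [ab|/ltW ba] := leP a b; first exact: hwlog.
  by rewrite distrC (distrC a b); exact: hwlog.
set p := 2^-1 * a ^+ 2; set q := 2^-1 * b ^+ 2.
have pq : p <= q by rewrite /p /q; nra.
rewrite ger0_norm; last by rewrite subr_ge0 ler_expR lerN2.
rewrite distrC ger0_norm ?subr_ge0//.
have p0 : 0 <= p by rewrite /p; nra.
have [ab1|/ltW ab1] := leP 1 (b - a).
  apply: le_trans ab1; apply: (@le_trans _ _ (expR (- p))).
    by rewrite gerBl expR_ge0.
  by rewrite -expR0 ler_expR oppr_le0.
have -> : expR (- q) = expR (- p) * expR (- (q - p)).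
  by rewrite -expRD; congr expR; ring.
have h1 : 1 - (q - p) <= expR (- (q - p)) by exact: expR_ge1Dx.
have h2 : expR (- p) * (1 + p) <= 1.
  rewrite expRN mulrC ler_pdivrMr ?expR_gt0// mul1r; exact: expR_ge1Dx.
have e0 : 0 < expR (- p) by exact: expR_gt0.
apply: (@le_trans _ _ (expR (- p) * (q - p))); first by nra.
have h3 : q - p <= (b - a) * (1 + p).
  have -> : q - p = (b - a) * (2^-1 * (a + b)) by rewrite /p /q; ring.
  apply: ler_wpM2l; first by rewrite subr_ge0.
  have := sqr_ge0 (a - 1); rewrite /p => h; nra.
apply: (@le_trans _ _ ((b - a) * (expR (- p) * (1 + p)))); last first.
  by rewrite ler_piMr// subr_ge0.
by rewrite mulrCA; apply: ler_wpM2l => //; exact: ltW.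
Qed.

(** A spanning family of minimal size is free: a vector with a nonzero
    coefficient in a relation could be dropped. *)
Lemma finite_dim_basis (R : realType) (V : lmodType R) : finite_dim V ->
  exists (n : nat) (e : 'I_n -> V),
    (forall v, exists c : 'I_n -> R, v = \sum_i c i *: e i) /\
    (forall c : 'I_n -> R, \sum_i c i *: e i = 0 -> forall i, c i = 0).
Proof.
move=> fV; pose spn n := exists e : 'I_n -> V,
  forall v, exists c : 'I_n -> R, v = \sum_i c i *: e i.
have spnP : exists n, `[< spn n >] by case: fV => n fV; exists n; apply/asboolP.
case: (ex_minnP spnP) => n /asboolP[e espan] nmin.
exists n, e; split=> // c c0 j; apply/eqP/negP => /negP cj0.
suff /nmin : `[< spn n.-1 >].
  by rewrite leqNgt => /negP; apply; rewrite prednK// (leq_ltn_trans _ (ltn_ord j)).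
apply/asboolP; exists (fun i => e (lift j i)) => v.
have [b ->] := espan v.
have ej : e j = - (c j)^-1 *: \sum_(i < n.-1) c (lift j i) *: e (lift j i).
  move: c0; rewrite (bigD1_ord j)//= => /eqP; rewrite addr_eq0 => /eqP cE.
  by rewrite scaleNr -scalerN -cE scalerA mulVf// scale1r.
exists (fun i => b (lift j i) - b j * (c j)^-1 * c (lift j i)).
rewrite (bigD1_ord j)//= ej scalerA scaler_sumr -big_split/=.
by apply: eq_bigr => i _; rewrite scalerA -scalerDl mulrN mulNr addrC.
Qed.

(** In the coordinates of a basis, v |-> |v| is continuous and positive on the
    compact unit sphere, hence bounded below there by some a > 0: the coordinates
    of v are at most |v| / a. *)
Lemma finite_dim_linear_bounded (R : realType) (V W : normedModType R)
    (f : {linear V -> W}) : finite_dim V ->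
  exists2 L : R, 0 < L & forall v, `|f v| <= L * `|v|.
Proof.
move=> /finite_dim_basis[n [e [espan efree]]].
pose phi (c : 'rV[R]_n) : V := \sum_i c ord0 i *: e i.
have phiZ a c : phi (a *: c) = a *: phi c.
  by rewrite /phi scaler_sumr; apply: eq_bigr => i _; rewrite mxE scalerA.
have phi_cont : continuous (fun c => `|phi c|).
  have phic : continuous phi.
    apply: (@continuous_big _ _ +%R) => [|i _ c]; first exact: add_continuous.
    exact: (cvgZr_tmp (@coord_continuous R 1 n ord0 i c)).
  by move=> c; exact: (cvg_norm (phic c)).
have [a a0 phi_ge] : exists2 a : R, 0 < a & forall c, a * `|c| <= `|phi c|.
  pose K := [set c : 'rV[R]_n | `|c| = 1].
  have [K0|/nonemptyPn K0] := pselect (K !=set0); last first.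
    exists 1 => // c; rewrite mul1r; have [->|c0] := eqVneq c 0.
      by rewrite normr0.
    have : K (`|c|^-1 *: c).
      by rewrite /K/= normrZ normfV normr_id mulVf// normr_eq0.
    by rewrite K0.
  have Kcomp : compact K.
    apply: bounded_closed_compact.
      exists 1; split; first by rewrite realE ler01.
      by move=> x x1 c /= ->; exact: ltW.
    have nc : continuous (fun c : 'rV[R]_n => `|c|) by move=> c; exact: norm_continuous.
    exact: (continuous_closedP _).1 nc _ (@closed_eq R 1).
  have [c0 c0K cmin] := EVT_min_rV K0 Kcomp (continuous_subspaceT phi_cont).
  exists `|phi c0|.
    rewrite normr_gt0; apply/eqP => /efree c00.
    move: c0K; rewrite inE /K/= (_ : c0 = 0) ?normr0.
      by move/eqP; rewrite eq_sym oner_eq0.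
    by apply/rowP => i; rewrite c00 mxE.
  move=> c; have [->|cn0] := eqVneq c 0; first by rewrite normr0 mulr0.
  have := cmin (`|c|^-1 *: c); rewrite inE /K/= normrZ normfV normr_id.
  rewrite mulVf ?normr_eq0// => /(_ erefl).
  rewrite phiZ normrZ normfV normr_id.
  by rewrite mulrC -ler_pdivlMr ?invr_gt0 ?normr_gt0// invrK.
pose B := \sum_i `|f (e i)|.
have B0 : 0 <= B by exact: sumr_ge0.
exists ((B + 1) / a) => [|v]; first by rewrite divr_gt0// ltr_wpDl.
have [c vc] := espan v; pose r : 'rV[R]_n := \row_i c i.
have vE : v = phi r by rewrite vc; apply: eq_bigr => i _; rewrite mxE.
apply: (@le_trans _ _ (B * `|r|)).
  rewrite vE /phi linear_sum /B mulr_suml; apply: le_trans (ler_norm_sum _ _ _) _.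
  apply: ler_sum => i _; rewrite linearZ normrZ mulrC ler_wpM2l//.
  rewrite [leRHS]/Num.norm/= mx_normrE.
  exact: (@le_bigmax _ _ _ _ (fun ij => `|r ij.1 ij.2|) (ord0, i)).
apply: (@le_trans _ _ ((B + 1) * `|r|)); first by rewrite ler_wpM2r// lerDl.
rewrite -mulrA ler_wpM2l//; first by rewrite addr_ge0.
by rewrite mulrC ler_pdivlMr// mulrC vE.
Qed.

Lemma continuous_borel_measurable (R : realType) (V : completeNormedModType R)
    (g : V -> R) :
  continuous g -> measurable_fun [set: borel V] (g : borel V -> R).
Proof.
move=> /continuousP cg; apply: (measurability _ (RGenOpens.measurableE R)).
move=> _ [_ [a [b ->] <-]]; rewrite setTI.
by apply: sub_sigma_algebra; apply: cg; exact: interval_open.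
Qed.

Lemma lipschitz_continuous (R : realType) (V : normedModType R) (g : V -> R)
    (L : R) : 0 < L -> (forall u v, `|g u - g v| <= L * `|u - v|) -> continuous g.
Proof.
move=> L0 gL u; apply/cvgrPdist_lt => e e0; near=> v.
apply: le_lt_trans (gL _ _) _; rewrite mulrC -ltr_pdivlMr//.
near: v; apply/nbhs_ballP; exists (e / L) => /=; first exact: divr_gt0.
by move=> v; rewrite -ball_normE.
Unshelve. all: by end_near. Qed.

(** [B], as the inverse of a linear map, is linear, hence bounded. *)
Lemma misfit_likelihood_lip (R : realType) (Y : normedModType R)
    (S : {linear Y -> Y}) (B : Y -> Y) (y : Y) :
  finite_dim Y -> cancel S B -> cancel B S ->
  exists2 L : R, 0 < L & forall u v,
    `|expR (- misfit B y u) - expR (- misfit B y v)| <= L * `|u - v|.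
Proof.
move=> Yfin SB BS.
have Blin : linear B by move=> a u v; rewrite -{1}(BS u) -{1}(BS v) -linearP SB.
pose BL := GRing.isLinear.Build _ _ _ _ B Blin.
pose Bl : {linear Y -> Y} := HB.pack B BL.
have [L L0 BL_] := @finite_dim_linear_bounded _ _ _ Bl Yfin.
exists L => // u v; rewrite /misfit.
apply: (le_trans (@expR_half_sqr_lip R _ _ _ _)) => //.
apply: le_trans (ler_dist_dist _ _) _.
have -> : B (y - u) - B (y - v) = Bl (v - u).
  by rewrite -[B]/(Bl : Y -> Y) -linearB opprB addrC addrA subrK.
by rewrite (distrC u); exact: BL_.
Qed.

(** * Integrals of bounded functions against a probability *)

Section toolkit.
Context (R : realType) (d : measure_display) (T : measurableType d).
Variable mu : probability T R.
Implicit Types f g : T -> R.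

Lemma bounded_integrable f (c : R) : measurable_fun setT f ->
  (forall x, `|f x| <= c) -> mu.-integrable setT (EFin \o f).
Proof.
move=> mf fc; apply: measurable_bounded_integrable => //.
  by apply: (le_lt_trans (@probability_le1 _ _ _ mu _ _)); rewrite ?ltry.
exists c; split; first exact: num_real.
by move=> x cx y _; exact: le_trans (fc y) (ltW cx).
Qed.

Lemma EFin_Rintegral f : mu.-integrable setT (EFin \o f) ->
  (\int[mu]_x (f x)%:E)%E = (\int[mu]_x f x)%:E.
Proof. by move=> intf; rewrite /Rintegral fineK//; exact: integrable_fin_num. Qed.

Lemma Rintegral_cstT (c : R) : \int[mu]_x c = c.
Proof.
rewrite Rintegral_cst//.
have -> : (mu : {measure set T -> \bar R}) setT = 1%E
  by exact: probability_setT.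
by rewrite mulr1.
Qed.

Lemma integrable_EFin_sum (I : finType) (h : I -> T -> R) :
  (forall i, mu.-integrable setT (EFin \o h i)) ->
  mu.-integrable setT (EFin \o (fun x => \sum_i h i x)).
Proof.
move=> ih; rewrite (_ : EFin \o _ = (fun x => \sum_i (EFin \o h i) x)%E).
  exact: integrable_sum.
by apply/funext => x /=; rewrite sumEFin.
Qed.

Lemma Rintegral_sum (I : finType) (h : I -> T -> R) :
  (forall i, mu.-integrable setT (EFin \o h i)) ->
  \int[mu]_x (\sum_i h i x) = \sum_i \int[mu]_x h i x.
Proof.
move=> ih; apply: EFin_inj; rewrite -EFin_Rintegral; last exact: integrable_EFin_sum.
under eq_integral do rewrite -sumEFin.
rewrite (integral_sum measurableT ih) -sumEFin.
by apply: eq_bigr => i _; rewrite EFin_Rintegral.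
Qed.

Lemma ae_le_Rintegral f g : mu.-integrable setT (EFin \o f) ->
  mu.-integrable setT (EFin \o g) -> {ae mu, forall x, f x <= g x} ->
  \int[mu]_x f x <= \int[mu]_x g x.
Proof.
move=> intf intg fg.
have intgf : mu.-integrable setT (EFin \o (fun x => g x - f x)).
  exact: (@integrableB _ _ _ mu setT measurableT _ _ intg intf).
rewrite -subr_ge0 -RintegralB//.
rewrite (_ : \int[mu]_x (g x - f x) = \int[mu]_x `|g x - f x|).
  exact: Rintegral_ge0.
congr fine; apply: ae_eq_integral => //.
- exact: measurable_int intgf.
- apply/measurable_EFinP; apply: measurableT_comp => //.
  by apply/measurable_EFinP; exact: measurable_int intgf.
- by apply: filterS fg => x fgx _; rewrite ger0_norm// subr_ge0.
Qed.

Lemma Rintegral_sqr_sub f (c : R) : measurable_fun setT f ->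
  (exists k : R, forall x, `|f x| <= k) ->
  \int[mu]_x (f x - c) ^+ 2 =
  \int[mu]_x (f x) ^+ 2 - 2 * c * \int[mu]_x f x + c ^+ 2.
Proof.
move=> mf [k fk].
have if1 : mu.-integrable setT (EFin \o f) by exact: bounded_integrable fk.
have if2 : mu.-integrable setT (EFin \o (fun x => f x ^+ 2)).
  apply: (@bounded_integrable _ (k ^+ 2)); first exact: measurable_funX.
  by move=> x; rewrite normrX ler_sqr// ?nnegrE// (le_trans _ (fk x)).
have if3 : mu.-integrable setT (EFin \o (fun x => 2 * c * f x)).
  apply: (@bounded_integrable _ (`|2 * c| * k)); first exact: measurable_funM.
  by move=> x; rewrite normrM ler_wpM2l.
have if4 : mu.-integrable setT (EFin \o (fun x => c ^+ 2)).
  exact: finite_measure_integrable_cst.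
have if5 : mu.-integrable setT (EFin \o (fun x => f x ^+ 2 - 2 * c * f x)).
  exact: (@integrableB _ _ _ mu setT measurableT _ _ if2 if3).
have sqrE x : (f x - c) ^+ 2 = (f x ^+ 2 - 2 * c * f x) + c ^+ 2 by ring.
under eq_Rintegral do rewrite sqrE.
by rewrite RintegralD// RintegralB// RintegralZl// Rintegral_cstT.
Qed.

Lemma sqr_Rintegral_le f : measurable_fun setT f ->
  (exists k : R, forall x, `|f x| <= k) ->
  (\int[mu]_x f x) ^+ 2 <= \int[mu]_x (f x) ^+ 2.
Proof.
move=> mf bf; have := @Rintegral_sqr_sub f (\int[mu]_x f x) mf bf.
have : 0 <= \int[mu]_x (f x - \int[mu]_x f x) ^+ 2.
  by apply: Rintegral_ge0 => x _; exact: sqr_ge0.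
lra.
Qed.

(** The integral of a nonnegative function is a supremum over the simple
    functions below it, so monotonicity holds without measurability.  This is
    what allows comparisons with z |-> ||exp(Phi_h(z, .))||_oo, whose
    measurability would need an argument of its own. *)
Lemma le_integral_ge0 (F G : T -> \bar R) : (forall x, 0 <= F x)%E ->
  (forall x, F x <= G x)%E -> (\int[mu]_x F x <= \int[mu]_x G x)%E.
Proof.
move=> F0 FG; rewrite !ge0_integralTE//; last first.
  by move=> x; exact: le_trans (FG x).
apply: le_ereal_sup => _ [h hF <-]; exists h => // x.
exact: le_trans (hF x) (FG x).
Qed.

End toolkit.

Lemma measurable_Rintegral_section (R : realType) (d1 d2 : measure_display)
    (T1 : measurableType d1) (T2 : measurableType d2)
    (m2 : probability T2 R) (k : T1 * T2 -> R) :
  measurable_fun setT k -> (forall z, 0 <= k z) ->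
  measurable_fun setT (fun x => \int[m2]_y k (x, y)).
Proof.
move=> mk k0; apply: (measurableT_comp (@fine_measurable R setT measurableT)).
apply: (@measurable_fun_fubini_tonelli_F _ _ _ _ _ m2 (EFin \o k)).
  exact/measurable_EFinP.
by move=> z; rewrite /= lee_fin.
Qed.

Lemma measurable_Rintegral_section_r (R : realType) (d1 d2 : measure_display)
    (T1 : measurableType d1) (T2 : measurableType d2)
    (m1 : probability T1 R) (k : T1 * T2 -> R) :
  measurable_fun setT k -> (forall z, 0 <= k z) ->
  measurable_fun setT (fun y => \int[m1]_x k (x, y)).
Proof.
move=> mk k0; apply: (measurableT_comp (@fine_measurable R setT measurableT)).
apply: (@measurable_fun_fubini_tonelli_G _ _ _ _ _ m1 (EFin \o k)).
  exact/measurable_EFinP.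
by move=> z; rewrite /= lee_fin.
Qed.

Lemma Rintegral_fubini (R : realType) (d1 d2 : measure_display)
    (T1 : measurableType d1) (T2 : measurableType d2)
    (m1 : probability T1 R) (m2 : probability T2 R) (k : T1 * T2 -> R) (c : R) :
  measurable_fun setT k -> (forall z, 0 <= k z <= c) ->
  \int[m1]_x \int[m2]_y k (x, y) = \int[m2]_y \int[m1]_x k (x, y).
Proof.
move=> mk k01; have k0 z : 0 <= k z by case/andP: (k01 z).
have kc z : `|k z| <= c by rewrite ger0_norm//; case/andP: (k01 z).
congr fine.
under eq_integral => x _.
  rewrite -EFin_Rintegral; last first.
    by apply: (@bounded_integrable _ _ _ _ _ c) => //; exact: measurableT_comp.
  over.
under [RHS]eq_integral => y _.
  rewrite -EFin_Rintegral; last first.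
    by apply: (@bounded_integrable _ _ _ _ _ c) => //; exact: measurableT_comp.
  over.
apply: (fubini_tonelli (EFin \o k)); first exact/measurable_EFinP.
by move=> z; rewrite /= lee_fin.
Qed.

(** * Hellinger distance of normalized densities *)

Lemma poweR_half_sqr (R : realType) (x : \bar R) : (0 <= x)%E ->
  ((x `^ (2^-1)) ^+ 2 = x)%E.
Proof.
case: x => [r| |]// r0.
  by rewrite poweR_EFin powR12_sqrt -?lee_fin// -EFin_expe sqr_sqrtr -?lee_fin.
by rewrite poweRyr ?invr_eq0 ?pnatr_eq0// expe2 mulyy.
Qed.

Section hellinger_density.
Context (R : realType) (d : measure_display) (T : measurableType d).
Variable mu : probability T R.

Lemma measurable_fun_sqrt (f : T -> R) :
  measurable_fun setT f -> measurable_fun setT (fun u => Num.sqrt (f u)).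
Proof.
move=> mf; apply: measurableT_comp mf.
by apply: continuous_measurable_fun; exact: sqrt_continuous.
Qed.

Lemma has_density_dominates (m : probability T R) (f : T -> R) :
  measurable_fun setT f -> has_density mu m f ->
  charge_of_finite_measure m `<< mu.
Proof.
move=> mf mE; apply/null_content_dominatesP => A mA muA0.
rewrite /= [LHS]mE//; apply: null_set_integral => //.
by apply: measurable_funTS; exact/measurable_EFinP.
Qed.

(** Radon-Nikodym derivatives are unique up to null sets, which identifies the
    derivative chosen in the definition of [hellinger] with any given density. *)
Lemma Radon_Nikodym_density (m : probability T R) (f : T -> R) :
  measurable_fun setT f -> has_density mu m f ->
  {ae mu, forall u, Radon_Nikodym (charge_of_finite_measure m) mu u = (f u)%:E}.
Proof.
move=> mf mE.
have dom := has_density_dominates mf mE.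
have : ae_eq mu setT (Radon_Nikodym (charge_of_finite_measure m) mu) (EFin \o f).
  apply: integral_ae_eq => //.
  - exact: Radon_Nikodym_integrable.
  - exact/measurable_EFinP.
  - by move=> E _ mE'; rewrite -Radon_Nikodym_integral//; exact: mE.
by apply: filterS => u; apply.
Qed.

Lemma sqr_hellinger (m m' : probability T R) (f g : T -> R) :
  measurable_fun setT f -> measurable_fun setT g ->
  has_density mu m f -> has_density mu m' g ->
  ((hellinger mu m m') ^+ 2 =
   (2^-1)%:E * \int[mu]_u ((Num.sqrt (f u) - Num.sqrt (g u)) ^+ 2)%:E)%E.
Proof.
move=> mf mg mE m'E; rewrite /hellinger poweR_half_sqr; last first.
  by rewrite mule_ge0 ?lee_fin ?invr_ge0// integral_ge0// => u _; rewrite lee_fin sqr_ge0.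
congr (_ * _)%E.
have mRN p q : measurable_fun setT q -> has_density mu p q ->
    measurable_fun setT (fun u => fine (Radon_Nikodym (charge_of_finite_measure p) mu u)).
  move=> mq pE; apply: (measurableT_comp (@fine_measurable R setT measurableT)).
  apply: measurable_int; apply: Radon_Nikodym_integrable.
  exact: has_density_dominates pE.
apply: ae_eq_integral => //.
- apply/measurable_EFinP/measurable_funX/measurable_funB; apply: measurable_fun_sqrt.
    exact: mRN mE.
  exact: mRN m'E.
- by apply/measurable_EFinP/measurable_funX/measurable_funB; exact: measurable_fun_sqrt.
have := Radon_Nikodym_density mf mE; have := Radon_Nikodym_density mg m'E.
by apply: filterS2 => u -> -> _.
Qed.

(** (x - y)^2 = (sqrt x - sqrt y)^2 (sqrt x + sqrt y)^2, and the last factor is at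
    least x. *)
Lemma sqr_sqrt_sub_le (c x y : R) : 0 < c -> 0 <= x -> 0 <= y -> c <= x ->
  (Num.sqrt x - Num.sqrt y) ^+ 2 <= c^-1 * (x - y) ^+ 2.
Proof.
move=> c0 x0 y0 cx; rewrite ler_pdivlMl//.
have := sqr_sqrtr x0; have := sqr_sqrtr y0.
have := sqrtr_ge0 x; have := sqrtr_ge0 y.
set a := Num.sqrt x; set b := Num.sqrt y => b0 a0 bE aE.
rewrite -[in leRHS]aE -[in leRHS]bE subr_sqr exprMn.
rewrite mulrC ler_wpM2l ?sqr_ge0//.
by apply: le_trans cx _; rewrite -aE ler_sqr ?nnegrE ?addr_ge0// lerDl.
Qed.

(** sqrt (x/p) - sqrt (y/q) splits into the change of density at fixed normalizer
    and the change of normalizer at fixed density. *)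
Lemma normalized_sqrt_sub_le (x y p q : R) : 0 <= x -> 0 <= y -> 0 < p -> 0 < q ->
  2^-1 * (Num.sqrt (x / p) - Num.sqrt (y / q)) ^+ 2 <=
  p^-1 * (Num.sqrt x - Num.sqrt y) ^+ 2 +
  y * ((Num.sqrt p)^-1 - (Num.sqrt q)^-1) ^+ 2.
Proof.
move=> x0 y0 p0 q0; rewrite !sqrtrM// !sqrtrV ?(ltW p0) ?(ltW q0)//.
have -> : p^-1 = (Num.sqrt p)^-1 ^+ 2 by rewrite exprVn sqr_sqrtr// ltW.
rewrite -[X in _ + X * _](sqr_sqrtr y0).
set a := Num.sqrt x; set b := Num.sqrt y.
set P := (Num.sqrt p)^-1; set Q := (Num.sqrt q)^-1.
have -> : a * P - b * Q = P * (a - b) + b * (P - Q) by ring.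
rewrite -!exprMn; set s := P * _; set t := b * _.
by have := sqr_ge0 (s - t); nra.
Qed.

(** The left-hand side is (sqrt p - sqrt q)^2 / p. *)
Lemma normalizer_sqrt_sub_le (p q : R) : 0 < p -> 0 < q ->
  q * ((Num.sqrt p)^-1 - (Num.sqrt q)^-1) ^+ 2 <= p^-1 ^+ 2 * (p - q) ^+ 2.
Proof.
move=> p0 q0; have p0' := ltW p0; have q0' := ltW q0.
have -> : q * ((Num.sqrt p)^-1 - (Num.sqrt q)^-1) ^+ 2 =
    p^-1 * (Num.sqrt p - Num.sqrt q) ^+ 2.
  have sp : Num.sqrt p != 0 by rewrite gt_eqF// sqrtr_gt0.
  have sq : Num.sqrt q != 0 by rewrite gt_eqF// sqrtr_gt0.
  rewrite -[X in X * _](sqr_sqrtr q0') -[X in X^-1 * _](sqr_sqrtr p0').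
  by field; apply/andP.
rewrite expr2 -mulrA ler_wpM2l ?invr_ge0//.
exact: sqr_sqrt_sub_le.
Qed.

(** Integrating [normalized_sqrt_sub_le]: [sqr_sqrt_sub_le] bounds the first part
    from whichever density is bounded below, and the second part is controlled by
    (p - q)^2, hence by the integral of (f - g)^2, since p - q is the integral of
    f - g. *)
Lemma hellinger_normalized_le (f g : T -> R) (c : R) :
  measurable_fun setT f -> measurable_fun setT g ->
  (forall u, 0 <= f u <= 1) -> (forall u, 0 <= g u <= 1) ->
  0 < \int[mu]_u f u -> 0 < \int[mu]_u g u -> 0 < c ->
  {ae mu, forall u, c <= f u} \/ {ae mu, forall u, c <= g u} ->
  ((2^-1)%:E * \int[mu]_u ((Num.sqrt (f u / \int[mu]_x f x)
                          - Num.sqrt (g u / \int[mu]_x g x)) ^+ 2)%:E <=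
   (((\int[mu]_x f x)^-1 * c^-1 + (\int[mu]_x f x)^-1 ^+ 2) *
     \int[mu]_u (f u - g u) ^+ 2)%:E)%E.
Proof.
move=> mf mg f01 g01; set p := \int[mu]_x f x; set q := \int[mu]_x g x.
move=> p0 q0 c0 cfg; set D := \int[mu]_u (f u - g u) ^+ 2.
have f0 u : 0 <= f u by case/andP: (f01 u).
have g0 u : 0 <= g u by case/andP: (g01 u).
have fn1 u : `|f u| <= 1 by rewrite ger0_norm//; case/andP: (f01 u).
have gn1 u : `|g u| <= 1 by rewrite ger0_norm//; case/andP: (g01 u).
have mfg : measurable_fun setT (fun u => f u - g u) by exact: measurable_funB.
have fg1 u : `|f u - g u| <= 1.
  by have := f01 u; have := g01 u; rewrite ler_norml; lra.
pose ka := ((Num.sqrt p)^-1 - (Num.sqrt q)^-1) ^+ 2.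
have ka0 : 0 <= ka by exact: sqr_ge0.
have i1 : mu.-integrable setT (EFin \o (fun u => p^-1 * c^-1 * (f u - g u) ^+ 2)).
  apply: (@bounded_integrable _ _ _ _ _ (p^-1 * c^-1)).
    by apply: measurable_funM => //; exact: measurable_funX.
  move=> u; rewrite normrM ger0_norm ?ler_piMr ?mulr_ge0 ?invr_ge0 ?(ltW p0) ?(ltW c0)//.
  by rewrite normrX exprn_ile1.
have i1' : mu.-integrable setT (EFin \o (fun u => (f u - g u) ^+ 2)).
  apply: (@bounded_integrable _ _ _ _ _ 1); first exact: measurable_funX.
  by move=> u; rewrite normrX exprn_ile1.
have i2' : mu.-integrable setT (EFin \o g) by exact: bounded_integrable gn1.
have i2 : mu.-integrable setT (EFin \o (fun u => ka * g u)).
  apply: (@bounded_integrable _ _ _ _ _ ka); first exact: measurable_funM.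
  by move=> u; rewrite normrM ger0_norm// ler_piMr.
have HE : \int[mu]_u (p^-1 * c^-1 * (f u - g u) ^+ 2 + ka * g u) =
    p^-1 * c^-1 * D + ka * q.
  by rewrite RintegralD// !RintegralZl.
have i3 : mu.-integrable setT
    (EFin \o (fun u => p^-1 * c^-1 * (f u - g u) ^+ 2 + ka * g u)).
  exact: (@integrableD _ _ _ mu setT measurableT _ _ i1 i2).
apply: (@le_trans _ _ (p^-1 * c^-1 * D + ka * q)%:E); last first.
  rewrite lee_fin mulrDl lerD2l mulrC.
  apply: (le_trans (normalizer_sqrt_sub_le p0 q0)).
  rewrite ler_wpM2l ?sqr_ge0//.
  rewrite /p /q -RintegralB//; last exact: bounded_integrable fn1.
  by apply: sqr_Rintegral_le => //; exists 1.
rewrite -HE -EFin_Rintegral// -ge0_integralZl//; last 2 first.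
- apply/measurable_EFinP/measurable_funX/measurable_funB;
    by apply: measurable_fun_sqrt; exact: measurable_funM.
- by move=> u _; rewrite lee_fin sqr_ge0.
apply: ae_ge0_le_integral => //.
- by move=> u _; rewrite -EFinM lee_fin mulr_ge0 ?invr_ge0 ?sqr_ge0.
- apply: measurable_funeM; apply/measurable_EFinP/measurable_funX/measurable_funB.
    by apply: measurable_fun_sqrt; exact: measurable_funM.
  by apply: measurable_fun_sqrt; exact: measurable_funM.
- move=> u _; rewrite lee_fin; apply: addr_ge0; apply: mulr_ge0 => //.
    by rewrite mulr_ge0 ?invr_ge0 ?(ltW p0) ?(ltW c0).
  exact: sqr_ge0.
- exact: measurable_int i3.
have key : {ae mu, forall u, (Num.sqrt (f u) - Num.sqrt (g u)) ^+ 2 <=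
    c^-1 * (f u - g u) ^+ 2}.
  case: cfg; apply: filterS => u cu; first exact: sqr_sqrt_sub_le.
  by rewrite -sqrrN opprB -(sqrrN (f u - g u)) opprB; exact: sqr_sqrt_sub_le.
apply: filterS key => u ku _; rewrite -EFinM lee_fin.
apply: (le_trans (normalized_sqrt_sub_le (f0 u) (g0 u) p0 q0)).
by rewrite -/ka (mulrC (g u)) lerD2r -mulrA ler_wpM2l// invr_ge0 ltW.
Qed.

End hellinger_density.

(** * Lower bounds for the unnormalized densities *)

(** The inverse function lies above its tangent at 1/t. *)
Lemma inv_tangent (R : realType) (t k : R) : 0 < k -> 2 * t - t ^+ 2 * k <= k^-1.
Proof.
move=> k0; rewrite -[leRHS]mul1r ler_pdivlMr//.
by have := sqr_ge0 (t * k - 1); nra.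
Qed.

Section lower_bounds.
Context (R : realType) (d : measure_display) (X : measurableType d).
Variable mu : probability X R.

Lemma ae_le_Lnorm_infty (f : X -> R) (r : R) :
  ('N[mu]_(+oo)[(fun u => (f u)%:E)] <= r%:E)%E -> {ae mu, forall u, f u <= r}.
Proof.
rewrite Lnorm.unlock /=.
have -> : (0 < (mu : {measure set X -> \bar R}) setT)%E.
  have -> : (mu : {measure set X -> \bar R}) setT = 1%E
  by exact: probability_setT.
  exact: lte01.
move/ess_supP; apply: filterS => u /=; rewrite lee_fin; exact: le_trans (ler_norm _).
Qed.

(** The tangents at the point C^-1 show that the mean of the inverses is at least
    2C - C^2 (mean of the k i), and it is at most C. *)
Lemma ae_mean_ge_of_Lnorm_mean_inv (I : finType) (k : I -> X -> R) (C w : R) :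
  0 < C -> 0 <= w -> w * #|I|%:R = 1 -> (forall i u, 0 < k i u) ->
  ('N[mu]_(+oo)[(fun u => (w * \sum_i (k i u)^-1)%:E)] <= C%:E)%E ->
  {ae mu, forall u, C^-1 <= w * \sum_i k i u}.
Proof.
move=> C0 w0 wI k0 /ae_le_Lnorm_infty; apply: filterS => u kC.
rewrite -[leLHS]mul1r ler_pdivrMr//.
have : w * \sum_i (2 * C - C ^+ 2 * k i u) <= C.
  apply: le_trans kC; rewrite ler_wpM2l//; apply: ler_sum => i _.
  exact: inv_tangent.
rewrite sumrB sumr_const -mulr_sumr -[_ *+ #|_|]mulr_natr.
rewrite (_ : w * (_ * _ - _) =
  2 * C * (w * #|I|%:R) - C ^+ 2 * (w * \sum_i k i u)); last ring.
rewrite wI.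
by set s := w * _; nra.
Qed.

(** Let A be the set where the conclusion fails, of measure m.  Were m positive,
    the average of 1 / k(z, .) over A, which is at most the essential supremum,
    would by the tangent at (2C)^-1 be at least 4C - 4C^2 (average of k(z, .) over
    A).  Averaging over z and exchanging the integrals would give 4C - 2C <= C.
    The factor 2 in the bound leaves the room that makes this a contradiction. *)
Lemma ae_mean_ge_of_mean_Lnorm_inv (d' : measure_display)
    (Omega : measurableType d') (nu : probability Omega R)
    (k : Omega * X -> R) (C : R) :
  0 < C -> measurable_fun setT k -> (forall z, 0 < k z <= 1) ->
  (\int[nu]_z 'N[mu]_(+oo)[(fun u => ((k (z, u))^-1)%:E)] <= C%:E)%E ->
  {ae mu, forall u, (2 * C)^-1 <= \int[nu]_w k (w, u)}.
Proof.
move=> C0 mk k01 NC.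
have k0 z : 0 < k z by case/andP: (k01 z).
have k1 z : k z <= 1 by case/andP: (k01 z).
pose a u := \int[nu]_w k (w, u).
have ma : measurable_fun setT a.
  by apply: measurable_Rintegral_section_r => // z; exact: ltW.
pose A := [set u | a u < (2 * C)^-1].
have mA : measurable A.
  have -> : A = setT `&` (fun u => a u < (2 * C)^-1) @^-1` [set true].
    by rewrite setTI; apply/seteqP; split.
  by apply: measurable_fun_ltr => //; exact: measurable_cst.
have mI : measurable_fun setT (\1_A : X -> R) by exact: measurable_indic.
have I01 u : 0 <= (\1_A u : R) <= 1 by rewrite indicE; case: (_ \in _); rewrite ler01 lexx.
have I0 u : 0 <= (\1_A u : R) by case/andP: (I01 u).
have I1 u : (\1_A u : R) <= 1 by case/andP: (I01 u).
pose m := \int[mu]_u (\1_A u : R).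
have muA : mu A = m%:E.
  rewrite /m -EFin_Rintegral; first by rewrite integral_indic// setIT.
  by apply: (@bounded_integrable _ _ _ _ _ 1) => // u; rewrite ger0_norm.
suff m0 : m <= 0.
  exists A; split=> //.
    by apply/eqP; rewrite eq_le measure_ge0 andbT muA lee_fin.
  by move=> u /= /negP; rewrite -ltNge.
rewrite leNgt; apply/negP => m0.
pose kA (z : Omega * X) := k z * \1_A z.2.
have mkA : measurable_fun setT kA.
  by apply: measurable_funM => //; exact: measurableT_comp.
have kA0 z : 0 <= kA z by rewrite mulr_ge0// ltW.
have kA1 z : kA z <= 1 by rewrite /kA mulr_ile1// ltW.
pose J z := \int[mu]_u kA (z, u).
have mJ : measurable_fun setT J by exact: measurable_Rintegral_section.
have ikA z : mu.-integrable setT (EFin \o (fun u => kA (z, u))).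
  apply: (@bounded_integrable _ _ _ _ _ 1); first exact: measurableT_comp.
  by move=> u; rewrite ger0_norm.
have iI : mu.-integrable setT (EFin \o (\1_A : X -> R)).
  by apply: (@bounded_integrable _ _ _ _ _ 1) => // u; rewrite ger0_norm.
have J0 z : 0 <= J z by exact: Rintegral_ge0.
have J1 z : J z <= 1.
  rewrite -(Rintegral_cstT mu 1); apply: le_Rintegral => //.
  exact: finite_measure_integrable_cst.
have EJ : \int[nu]_z J z <= m * (2 * C)^-1.
  rewrite /J (@Rintegral_fubini _ _ _ _ _ _ _ kA 1) => //; last by move=> z; rewrite kA0 kA1.
  rewrite /m -RintegralZr//; apply: le_Rintegral => //.
  - apply: (@bounded_integrable _ _ _ _ _ 1).
      exact: measurable_Rintegral_section_r.
    move=> u; rewrite ger0_norm ?Rintegral_ge0//.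
    rewrite -(Rintegral_cstT nu 1); apply: le_Rintegral => //.
      apply: (@bounded_integrable _ _ _ _ _ 1); first exact: measurableT_comp.
      by move=> z; rewrite ger0_norm.
    exact: finite_measure_integrable_cst.
  - apply: (@bounded_integrable _ _ _ _ _ (2 * C)^-1).
      exact: measurable_funM.
    have c0 : 0 <= (2 * C)^-1 by rewrite invr_ge0 mulr_ge0// ltW.
    by move=> u; rewrite ger0_norm ?mulr_ge0// ler_piMl.
  - move=> u _; rewrite /kA /= RintegralZr//; last first.
      apply: (@bounded_integrable _ _ _ _ _ 1); first exact: measurableT_comp.
      by move=> z; rewrite ger0_norm// ltW.
    rewrite indicE mulrC; case: (boolP (u \in A)) => [|_]; last by rewrite !mul0r.
    by rewrite inE !mul1r; exact: ltW.
have C24 : 0 <= 4 * C ^+ 2 by rewrite mulr_ge0// sqr_ge0.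
have c40 : 0 <= 4 * C ^+ 2 * m^-1 by rewrite mulr_ge0// invr_ge0 ltW.
have C40 : 0 <= 4 * C by rewrite mulr_ge0// ltW.
(* [ka] is a measurable minorant of the essential supremum: the average over A
   of the tangent at (2C)^-1, with J z / m the average of k(z, .) over A. *)
pose ka z := Num.max (4 * C - 4 * C ^+ 2 * m^-1 * J z) 0.
have mka : measurable_fun setT ka.
  apply: measurable_maxr => //; apply: measurable_funB => //.
  exact: measurable_funM.
have ka0 z : 0 <= ka z by rewrite /ka le_max lexx orbT.
have kaC z : ka z <= 4 * C.
  by rewrite /ka ge_max C40 andbT gerBl mulr_ge0.
have ika : nu.-integrable setT (EFin \o ka).
  by apply: (@bounded_integrable _ _ _ _ _ (4 * C)) => // z; rewrite ger0_norm.
have kaN z : ((ka z)%:E <= 'N[mu]_(+oo)[(fun u => ((k (z, u))^-1)%:E)])%E.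
  have := @ae_le_Lnorm_infty (fun u => (k (z, u))^-1).
  have := Lnorm_ge0 mu +oo%E (fun u => ((k (z, u))^-1)%:E).
  case: (Lnorm _ _ _) => [r|_ _|//]; last by rewrite leey.
  rewrite lee_fin => r0 /(_ r (lexx _)) kr; rewrite lee_fin ge_max r0 andbT.
  have : 4 * C * m <= r * m + 4 * C ^+ 2 * J z.
    rewrite /m /J -!RintegralZl// -RintegralD//; last 2 first.
    + apply: (@bounded_integrable _ _ _ _ _ r); first exact: measurable_funM.
      by move=> u; rewrite ger0_norm ?ler_piMr// mulr_ge0.
    + apply: (@bounded_integrable _ _ _ _ _ (4 * C ^+ 2)).
        by apply: measurable_funM => //; exact: measurableT_comp.
      by move=> u; rewrite ger0_norm ?ler_piMr// mulr_ge0.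
    apply: ae_le_Rintegral.
    + apply: (@bounded_integrable _ _ _ _ _ (4 * C)); first exact: measurable_funM.
      by move=> u; rewrite ger0_norm ?ler_piMr// mulr_ge0.
    + apply: (@bounded_integrable _ _ _ _ _ (r + 4 * C ^+ 2)).
        apply: measurable_funD; first exact: measurable_funM.
        by apply: measurable_funM => //; exact: measurableT_comp.
      move=> u; rewrite ger0_norm; last by apply: addr_ge0; exact: mulr_ge0.
      by rewrite lerD// ler_piMr.
    apply: filterS kr => u ku; rewrite /kA/= mulrA -mulrDl ler_wpM2r//.
    have := inv_tangent (2 * C) (k0 (z, u)).
    rewrite exprMn; lra.
  move=> h; rewrite -(ler_pM2r m0) mulrBl lerBlDr; apply: (le_trans h).
  rewrite lerD2l le_eqVlt; apply/orP; left; apply/eqP.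
  by field; rewrite gt_eqF.
have Eka : \int[nu]_z ka z <= C.
  rewrite -lee_fin -EFin_Rintegral//; apply: le_trans NC.
  by apply: le_integral_ge0 => // z; rewrite lee_fin.
have : 4 * C <= \int[nu]_z ka z + 4 * C ^+ 2 * m^-1 * \int[nu]_z J z.
  have iJ : nu.-integrable setT (EFin \o J).
    by apply: (@bounded_integrable _ _ _ _ _ 1) => // z; rewrite ger0_norm.
  have iJ' : nu.-integrable setT (EFin \o (fun z => 4 * C ^+ 2 * m^-1 * J z)).
    apply: (@bounded_integrable _ _ _ _ _ (4 * C ^+ 2 * m^-1)); first exact: measurable_funM.
    by move=> z; rewrite ger0_norm ?ler_piMr// mulr_ge0.
  rewrite -RintegralZl// -RintegralD// -[leLHS](Rintegral_cstT nu).
  apply: le_Rintegral => //.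
  - exact: finite_measure_integrable_cst.
  - exact: (@integrableD _ _ _ nu setT measurableT _ _ ika iJ').
  - by move=> z _; rewrite -lerBlDr /ka le_max lexx.
have : 4 * C ^+ 2 * m^-1 * \int[nu]_z J z <= 2 * C.
  apply: (@le_trans _ _ (4 * C ^+ 2 * m^-1 * (m * (2 * C)^-1))).
    by rewrite ler_wpM2l.
  suff -> : 4 * C ^+ 2 * m^-1 * (m * (2 * C)^-1) = 2 * C by [].
  by field; rewrite !gt_eqF.
by nra.
Qed.

End lower_bounds.

(** * Means of independent samples *)

Section sampling.
Context (R : realType) (d d' : measure_display).
Context (S : measurableType d) (Omega : measurableType d').
Context (P : probability S R) (nu : probability Omega R).
Context (M : nat) (xi : 'I_M -> {mfun S >-> Omega}).
Hypothesis xi_iid : iid_sample P nu xi.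

Lemma iid_Rintegral (i : 'I_M) (f : Omega -> R) :
  measurable_fun setT f -> (forall z, 0 <= f z) ->
  \int[P]_w f (xi i w) = \int[nu]_z f z.
Proof.
move=> mf f0; congr fine.
have mxi : measurable_fun setT (xi i) by [].
have mEf : measurable_fun setT (EFin \o f) by exact/measurable_EFinP.
have E := @ge0_integral_pushforward _ _ _ _ R _ mxi P setT (EFin \o f) measurableT mEf.
rewrite preimage_setT in E.
rewrite -E; last by move=> z _; rewrite /= lee_fin.
by apply: eq_measure_integral => A mA _; exact: xi_iid.1.
Qed.

(** By uniqueness of product measures, the pair (xi i, xi j) has law
    nu \x nu. *)
Lemma iid_Rintegral_prod (i j : 'I_M) (f : Omega -> R) : i != j ->
  measurable_fun setT f -> (forall z, 0 <= f z <= 1) ->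
  \int[P]_w (f (xi i w) * f (xi j w)) = (\int[nu]_z f z) ^+ 2.
Proof.
move=> ij mf f01; have f0 z : 0 <= f z by case/andP: (f01 z).
have f1 z : f z <= 1 by case/andP: (f01 z).
pose ph w := (xi i w, xi j w).
have mph : measurable_fun setT ph by exact: measurable_fun_pair.
pose F (z : Omega * Omega) := f z.1 * f z.2.
have mF : measurable_fun setT F.
  by apply: measurable_funM; exact: measurableT_comp.
have F0 z : 0 <= F z by exact: mulr_ge0.
have mEF : measurable_fun setT (EFin \o F) by exact/measurable_EFinP.
have E := @ge0_integral_pushforward _ _ _ _ R _ mph P setT (EFin \o F) measurableT mEF.
rewrite preimage_setT in E.
(* The packaged version of [ph], for which the image of P is known to be a
   measure. *)
pose ph' : {mfun S >-> (Omega * Omega)%type} :=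
  HB.pack ph (isMeasurableFun.Build _ _ _ _ _ mph).
have lawE A : measurable A -> (nu \x nu)%E A = pushforward P ph A.
  move=> mA; apply: (@product_measure_unique _ _ _ _ R nu nu (pushforward P ph')) => //
    B C mB mC.
  rewrite /pushforward.
  have := xi_iid.2 [set i; j]%SET (fun k => if k == i then B else C).
  rewrite big_setU1 ?inE//= big_set1 eqxx eq_sym (negbTE ij).
  rewrite !xi_iid.1// => <-; last by move=> k; case: ifP.
  congr (P _); apply/seteqP; split => w /=.
    by move=> [Bi Cj] k /=; rewrite !inE => /orP[] /eqP ->; rewrite ?eqxx//
      eq_sym (negbTE ij).
  move=> h; split; have := h i; have := h j;
    rewrite /= !inE !eqxx orbT eq_sym (negbTE ij).
    by move=> _; exact.
  by move=> + _; exact.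
have -> : \int[P]_w (f (xi i w) * f (xi j w)) = fine (\int[nu \x nu]_z (F z)%:E)%E.
  congr fine; rewrite (eq_measure_integral (pushforward P ph)); last first.
    by move=> A mA _; exact: lawE.
  by rewrite E// => z _; rewrite /= lee_fin.
rewrite (fubini_tonelli1 (EFin \o F))//.
transitivity (\int[nu]_x \int[nu]_y F (x, y)).
  congr fine; apply: eq_integral => x _.
  rewrite /fubini_F -EFin_Rintegral//.
  apply: (@bounded_integrable _ _ _ _ _ 1); first exact: measurableT_comp.
  by move=> y; rewrite ger0_norm// mulr_ile1.
have intf : nu.-integrable setT (EFin \o f).
  by apply: (@bounded_integrable _ _ _ _ _ 1) => // y; rewrite ger0_norm.
under eq_Rintegral => x _ do rewrite /F /= RintegralZl//.
by rewrite RintegralZr// expr2.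
Qed.

(** In the double sum expanding the square of the mean, the M^2 - M off-diagonal
    terms contribute the square of the expectation by independence; what remains
    is the variance of f over M, and a variance is at most the mean square
    distance to [c]. *)
Lemma iid_mean_sqr_error (f : Omega -> R) (c : R) : (0 < M)%N ->
  measurable_fun setT f -> (forall z, 0 <= f z <= 1) ->
  \int[P]_w (\int[nu]_z f z - M%:R^-1 * \sum_i f (xi i w)) ^+ 2
  <= M%:R^-1 * \int[nu]_z (f z - c) ^+ 2.
Proof.
move=> M0 mf f01; have f0 z : 0 <= f z by case/andP: (f01 z).
have f1 z : f z <= 1 by case/andP: (f01 z).
have bf : exists k : R, forall z, `|f z| <= k by exists 1 => z; rewrite ger0_norm.
have MR0 : (0 : R) < M%:R by rewrite ltr0n.
set m := \int[nu]_z f z; pose v := \int[nu]_z (f z) ^+ 2.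
pose b w : R := M%:R^-1 * \sum_i f (xi i w).
have mfi i : measurable_fun setT (fun w => f (xi i w)) by exact: measurableT_comp.
have mb : measurable_fun setT b.
  by apply: measurable_funM => //; exact: measurable_sum.
have b0 w : 0 <= b w by rewrite mulr_ge0 ?invr_ge0 ?sumr_ge0// ltW.
have b1 w : b w <= 1.
  rewrite /b ler_pdivrMl// mulr1.
  apply: (@le_trans _ _ (\sum_(i < M) 1)); first by apply: ler_sum.
  by rewrite sumr_const card_ord.
have bb : exists k : R, forall w, `|b w| <= k by exists 1 => w; rewrite ger0_norm.
have ifi i : P.-integrable setT (EFin \o (fun w => f (xi i w))).
  by apply: (@bounded_integrable _ _ _ _ _ 1) => // w; rewrite ger0_norm.
have iff i j : P.-integrable setT (EFin \o (fun w => f (xi i w) * f (xi j w))).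
  apply: (@bounded_integrable _ _ _ _ _ 1); first exact: measurable_funM.
  by move=> w; rewrite ger0_norm ?mulr_ge0// mulr_ile1.
have Eb : \int[P]_w b w = m.
  rewrite RintegralZl//; last exact: integrable_EFin_sum.
  rewrite Rintegral_sum//; under eq_bigr do rewrite iid_Rintegral//.
  by rewrite sumr_const card_ord -[m *+ M]mulr_natl mulrA mulVf ?mul1r// gt_eqF.
have Ebb : \int[P]_w (b w) ^+ 2 = m ^+ 2 + M%:R^-1 * (v - m ^+ 2).
  have bbE w : b w ^+ 2 = M%:R^-1 ^+ 2 * \sum_(p : 'I_M * 'I_M) f (xi p.1 w) * f (xi p.2 w).
    rewrite /b exprMn; congr (_ * _).
    by rewrite expr2 big_distrlr /= pair_big.
  under eq_Rintegral do rewrite bbE.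
  rewrite RintegralZl//; last first.
    exact: (@integrable_EFin_sum _ _ _ P _
      (fun (p : 'I_M * 'I_M) w => f (xi p.1 w) * f (xi p.2 w))).
  rewrite (@Rintegral_sum _ _ _ P _
      (fun (p : 'I_M * 'I_M) w => f (xi p.1 w) * f (xi p.2 w)))//.
  rewrite (eq_bigr (fun p : 'I_M * 'I_M =>
      m ^+ 2 + (if p.1 == p.2 then v - m ^+ 2 else 0))).
    rewrite -(pair_big xpredT xpredT (fun i j : 'I_M =>
      m ^+ 2 + (if i == j then v - m ^+ 2 else 0)))/=.
    have rowE (i : 'I_M) : \sum_(j < M) (m ^+ 2 + (if i == j then v - m ^+ 2 else 0)) =
        M%:R * m ^+ 2 + (v - m ^+ 2).
      rewrite big_split/= sumr_const card_ord -[_ *+ M]mulr_natl (bigD1 i)//= eqxx.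
      by rewrite big1 ?addr0// => j; rewrite eq_sym => /negbTE ->.
    under eq_bigr do rewrite rowE.
    rewrite sumr_const card_ord -[_ *+ M]mulr_natl.
    by field; rewrite gt_eqF.
  move=> [i j] _ /=; case: eqP => [->|/eqP ij].
    rewrite addrC subrK; apply: (@iid_Rintegral j (fun z => f z ^+ 2)).
      exact: measurable_funX.
    by move=> z; exact: sqr_ge0.
  by rewrite addr0 iid_Rintegral_prod.
have -> : \int[P]_w (m - M%:R^-1 * \sum_i f (xi i w)) ^+ 2 = \int[P]_w (b w - m) ^+ 2.
  by apply: eq_Rintegral => w _; rewrite -sqrrN opprB.
rewrite Rintegral_sqr_sub// Rintegral_sqr_sub// Ebb Eb -/v -/m.
rewrite [leLHS](_ : _ = M%:R^-1 * (v - m ^+ 2)); last ring.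
rewrite ler_wpM2l ?invr_ge0 ?(ltW MR0)//.
by have := sqr_ge0 (m - c); nra.
Qed.

End sampling.

(** * Monte Carlo approximation of a marginal density *)

Lemma measurable_fun_inv (R : realType) (d : measure_display)
    (T : measurableType d) (f : T -> R) :
  (forall x, 0 <= f x) -> measurable_fun setT f ->
  measurable_fun setT (fun x => (f x)^-1).
Proof.
move=> f0 mf; rewrite (_ : (fun _ => _) = (fun x => f x `^ (-1))).
  exact: (measurableT_comp (@measurable_powR R (-1)) mf).
by apply/funext => x; rewrite powR_inv1.
Qed.

(** Here [k] stands for exp(-Phi_h), [a] for its mean and [b] for its sample
    mean. *)
Section monte_carlo.
Context (R : realType) (d d' dX : measure_display).
Context (S : measurableType d) (Omega : measurableType d') (X : measurableType dX).
Context (P : probability S R) (nu : probability Omega R) (mu : probability X R).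
Context (M : nat) (xi : 'I_M -> {mfun S >-> Omega}).
Context (k : Omega * X -> R).
Hypotheses (M0 : (0 < M)%N) (xi_iid : iid_sample P nu xi).
Hypotheses (mk : measurable_fun setT k) (k01 : forall z, 0 < k z <= 1).

Let a u := \int[nu]_z k (z, u).
Let b w u := M%:R^-1 * \sum_(i < M) k (xi i w, u).

Let k0 z : 0 <= k z. Proof. by apply: ltW; case/andP: (k01 z). Qed.
Let k1 z : k z <= 1. Proof. by case/andP: (k01 z). Qed.
Let MR0 : (0 : R) < M%:R. Proof. by rewrite ltr0n. Qed.

Let ma : measurable_fun setT a.
Proof. exact: measurable_Rintegral_section_r. Qed.

Let a01 u : 0 <= a u <= 1.
Proof.
rewrite Rintegral_ge0//= -(Rintegral_cstT nu 1).
apply: le_Rintegral => //; last exact: finite_measure_integrable_cst.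
apply: (@bounded_integrable _ _ _ _ _ 1); first exact: measurableT_comp.
by move=> z; rewrite ger0_norm.
Qed.

Let mb : measurable_fun setT (fun z : S * X => b z.1 z.2).
Proof.
apply: measurable_funM => //; apply: measurable_sum => i.
apply: (measurableT_comp mk).
by apply: measurable_fun_pair => //; exact: measurableT_comp.
Qed.

Let b01 w u : 0 <= b w u <= 1.
Proof.
apply/andP; split; first by rewrite mulr_ge0 ?invr_ge0 ?sumr_ge0// ltW.
rewrite ler_pdivrMl// mulr1.
apply: (@le_trans _ _ (\sum_(i < M) 1)); first by apply: ler_sum.
by rewrite sumr_const card_ord.
Qed.

Let mbw w : measurable_fun setT (b w).
Proof. exact: (measurableT_comp mb (pair1_measurable w)). Qed.

Let mab : measurable_fun setT (fun z : S * X => (a z.2 - b z.1 z.2) ^+ 2).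
Proof.
apply: measurable_funX; apply: measurable_funB => //.
exact: measurableT_comp.
Qed.

Let ab01 w u : 0 <= (a u - b w u) ^+ 2 <= 1.
Proof.
rewrite sqr_ge0/= -real_normK ?num_real// exprn_ile1//.
by have := a01 u; have := b01 w u; rewrite ler_norml; lra.
Qed.

(** Exchanging the integrals reduces to [iid_mean_sqr_error] at each u; the
    function g of u is the point around which the variance is bounded. *)
Lemma monte_carlo_mean_sqr_error (g : X -> R) (D : R) :
  {ae mu, forall u, \int[nu]_z (k (z, u) - g u) ^+ 2 <= D} ->
  \int[P]_w \int[mu]_u (a u - b w u) ^+ 2 <= M%:R^-1 * D.
Proof.
move=> gD; rewrite (@Rintegral_fubini _ _ _ _ _ P mu _ 1 mab) => [|z]; last exact: ab01.
rewrite -[leRHS](Rintegral_cstT mu); apply: ae_le_Rintegral.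
- apply: (@bounded_integrable _ _ _ _ _ 1).
    by apply: (measurable_Rintegral_section_r P mab) => z; exact: sqr_ge0.
  move=> u; rewrite ger0_norm ?Rintegral_ge0//; last by move=> w _; exact: sqr_ge0.
  rewrite -(Rintegral_cstT P 1).
  apply: le_Rintegral => //; last by move=> w _; case/andP: (ab01 w u).
    apply: (@bounded_integrable _ _ _ _ _ 1).
      exact: (measurableT_comp mab (pair2_measurable u)).
    by move=> w; rewrite ger0_norm ?sqr_ge0//; case/andP: (ab01 w u).
  exact: finite_measure_integrable_cst.
- exact: finite_measure_integrable_cst.
apply: filterS gD => u gD /=.
have mku : measurable_fun setT (fun z => k (z, u)) by exact: measurableT_comp.
apply: (le_trans (iid_mean_sqr_error xi_iid (g u) M0 mku _)) => [z|].
  by rewrite k0 k1.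
by rewrite ler_wpM2l// invr_ge0 ltW.
Qed.

(** The hypothesis on the minimum gives, for almost every sample, a lower bound
    (2 C1)^-1 on a or on b, according to which term realizes the minimum. *)
Lemma mean_sqr_hellinger_le (g : X -> R) (C1 C3 C4 D : R)
    (m : probability X R) (mM : S -> probability X R) :
  0 < C1 -> 0 < C3 -> 0 < C4 ->
  {ae P, forall w,
    (Order.min
      (\int[nu]_z 'N[mu]_(+oo)[(fun u => ((k (z, u))^-1)%:E)])
      ('N[mu]_(+oo)[(fun u => (M%:R^-1 * \sum_(i < M) (k (xi i w, u))^-1)%:E)])
     <= C1%:E)%E} ->
  C3^-1 <= \int[mu]_u a u ->
  {ae P, forall w, C4^-1 <= \int[mu]_u b w u} ->
  {ae mu, forall u, \int[nu]_z (k (z, u) - g u) ^+ 2 <= D} ->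
  has_density mu m (fun u => a u / \int[mu]_x a x) ->
  (forall w, has_density mu (mM w) (fun u => b w u / \int[mu]_x b w x)) ->
  (\int[P]_w (hellinger mu m (mM w)) ^+ 2 <=
    ((C3 * (2 * C1) + C3 ^+ 2) * (M%:R^-1 * D))%:E)%E.
Proof.
move=> C10 C30 C40 hN aC3 bC4 gD mE mME.
have pa0 : 0 < \int[mu]_u a u by apply: lt_le_trans aC3; rewrite invr_gt0.
have b0 w u : 0 <= b w u by case/andP: (b01 w u).
have bI0 w : 0 <= \int[mu]_u b w u by exact: Rintegral_ge0.
have mhb : measurable_fun setT (fun z : S * X => b z.1 z.2 / \int[mu]_x b z.1 x).
  apply: measurable_funM => //; apply: measurable_fun_inv => //.
  apply: (@measurableT_comp _ _ _ _ _ _ (fun w => \int[mu]_x b w x)) => //.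
  exact: (measurable_Rintegral_section _ mb).
have mha : measurable_fun setT (fun u => a u / \int[mu]_x a x).
  exact: measurable_funM.
have mhbw w : measurable_fun setT (fun u => b w u / \int[mu]_x b w x).
  exact: measurable_funM.
pose H (z : S * X) := ((Num.sqrt (a z.2 / \int[mu]_x a x) -
  Num.sqrt (b z.1 z.2 / \int[mu]_x b z.1 x)) ^+ 2)%:E.
have mH : measurable_fun setT H.
  apply/measurable_EFinP/measurable_funX/measurable_funB.
    by apply: measurable_fun_sqrt; exact: measurableT_comp mha measurable_snd.
  exact: measurable_fun_sqrt.
have hE w : ((hellinger mu m (mM w)) ^+ 2 =
    (2^-1)%:E * \int[mu]_u H (w, u))%E.
  exact: sqr_hellinger (mME w).
under eq_integral do rewrite hE.
pose K := C3 * (2 * C1) + C3 ^+ 2.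
have K0 : 0 <= K by rewrite addr_ge0 ?sqr_ge0// !mulr_ge0// ltW.
pose E w := \int[mu]_u (a u - b w u) ^+ 2.
have mE' : measurable_fun setT E.
  by apply: (measurable_Rintegral_section _ mab) => z; exact: sqr_ge0.
have E0 w : 0 <= E w by apply: Rintegral_ge0 => u _; exact: sqr_ge0.
have E1 w : E w <= 1.
  rewrite -(Rintegral_cstT mu 1); apply: le_Rintegral => //; last first.
  - by move=> u _; case/andP: (ab01 w u).
  - exact: finite_measure_integrable_cst.
  apply: (@bounded_integrable _ _ _ _ _ 1).
    exact: (measurableT_comp mab (pair1_measurable w)).
  by move=> u; rewrite ger0_norm ?sqr_ge0//; case/andP: (ab01 w u).
have iE : P.-integrable setT (EFin \o E).
  by apply: (@bounded_integrable _ _ _ _ _ 1) => // w; rewrite ger0_norm.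
have iKE : P.-integrable setT (EFin \o (fun w => K * E w)).
  apply: (@bounded_integrable _ _ _ _ _ K); first exact: measurable_funM.
  by move=> w; rewrite ger0_norm ?ler_piMr// mulr_ge0.
apply: (@le_trans _ _ (\int[P]_w (K * E w)%:E)%E); last first.
  rewrite EFin_Rintegral// lee_fin RintegralZl// ler_wpM2l//.
  exact: monte_carlo_mean_sqr_error gD.
have H0 z : (0 <= H z)%E by rewrite lee_fin sqr_ge0.
apply: ae_ge0_le_integral => //.
- by move=> w _; rewrite mule_ge0 ?lee_fin ?invr_ge0// integral_ge0.
- by apply: measurable_funeM; exact: (measurable_fun_fubini_tonelli_F H).
- by move=> w _; rewrite lee_fin mulr_ge0.
- exact: measurable_int iKE.
apply: filterS2 hN bC4 => w hN bC4 _.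
have pb0 : 0 < \int[mu]_u b w u by apply: lt_le_trans bC4; rewrite invr_gt0.
have c0 : 0 < (2 * C1)^-1 by rewrite invr_gt0 mulr_gt0.
have cab : {ae mu, forall u, (2 * C1)^-1 <= a u} \/
           {ae mu, forall u, (2 * C1)^-1 <= b w u}.
  move: hN; rewrite ge_min => /orP[hN|hN]; [left|right].
    exact: ae_mean_ge_of_mean_Lnorm_inv hN.
  have := @ae_mean_ge_of_Lnorm_mean_inv _ _ _ mu _
    (fun i u => k (xi i w, u)) C1 M%:R^-1 C10.
  rewrite invr_ge0 (ltW MR0) card_ord mulVf ?gt_eqF// => /(_ isT erefl).
  have kp i u : 0 < k (xi i w, u) by case/andP: (k01 (xi i w, u)).
  move=> /(_ kp hN); apply: filterS => u; apply: le_trans.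
  by rewrite lef_pV2 ?posrE ?mulr_gt0// ler_peMl ?(ltW C10)// ler1n.
apply: (le_trans (hellinger_normalized_le ma (mbw w) a01 (b01 w) pa0 pb0 c0 cab)).
rewrite lee_fin -/(E w) ler_wpM2r//.
have paC : (\int[mu]_u a u)^-1 <= C3.
  by rewrite -[leRHS]invrK lef_pV2 ?posrE ?invr_gt0.
have pai0 : 0 <= (\int[mu]_u a u)^-1 by rewrite invr_ge0 ltW.
rewrite /K invrK lerD//; first by rewrite ler_wpM2r// mulr_ge0// ltW.
by rewrite ler_sqr ?nnegrE// ltW.
Qed.

End monte_carlo.

(** * Convergence rate *)

Unset Implicit Arguments.
Set Strict Implicit.

Theorem theorem3p2 (R : realType)
  (X Y : completeNormedModType R) (Y_fin : finite_dim Y)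
  (G : X -> Y)
  (mG : measurable_fun [set: borel X] (G : borel X -> borel Y))
  (y : Y)
  (ip : {dot Y for (@idfun R)}) (Gamma : {linear Y -> Y})
  (Gamma_cov : covariance_endo ip Gamma) (Gamma_nonsing : bijective Gamma)
  (Gamma_mhalf : Y -> Y) (Gamma_mhalfP : is_inv_sqrt ip Gamma Gamma_mhalf)
  (m0 : X) (C0 : (X -> R) -> X)
  (C0_cov : covariance_operator C0) (C0_trace : trace_class C0)
  (mu0 : probability (borel X) R) (mu0_gauss : gaussian_measure m0 C0 mu0)
  (d : measure_display) (Omega : measurableType d)
  (nu : R -> probability Omega R)
  (Gh : R -> Omega * borel X -> Y)
  (mGh : forall h, 0 < h ->
     measurable_fun [set: Omega * borel X] (Gh h : Omega * borel X -> borel Y))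
  (dS : R -> nat -> measure_display) (S : forall h M, measurableType (dS h M))
  (P : forall h M, probability (S h M) R)
  (xi : forall h M, 'I_M -> {mfun S h M >-> Omega})
  (xi_iid : forall h M, 0 < h -> (0 < M)%N ->
     iid_sample (P h M) (nu h) (xi h M))
  (s : R) (s_gt0 : 0 < s)
  (ms_order : mean_square_order mu0 nu G Gh s) :
  let Phi (u : borel X) := misfit Gamma_mhalf y (G u) in
  let Phih h w (u : borel X) := misfit Gamma_mhalf y (Gh h (w, u)) in
  boundedness mu0 nu P xi Phi Phih ->
  forall (mu_m : R -> probability (borel X) R)
    (mu_mM : forall h M, S h M -> probability (borel X) R),
  (forall h, 0 < h ->
     has_density mu0 (mu_m h) (marginal_density mu0 (nu h) (Phih h))) ->
  (forall h M w, 0 < h -> (0 < M)%N ->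
     has_density mu0 (mu_mM h M w)
       (mc_density mu0 (fun i : 'I_M => Phih h (xi h M i w)))) ->
  exists2 C : R, 0 < C &
    forall h M, 0 < h -> (0 < M)%N ->
      ((\int[P h M]_w (hellinger mu0 (mu_m h) (mu_mM h M w)) ^+ 2) `^ (2^-1)
        <= (C * (h `^ s / Num.sqrt M%:R))%:E)%E.
Proof.
move=> Phi Phih [C1 [C2 [C3 [C4 [[C10 _ C30 C40] [hi _ hiii hiv]]]]]]
  mu_m mu_mM hm hmM.
have [Sg [_ _ SB BS]] := Gamma_mhalfP.
have [L L0 lip] := misfit_likelihood_lip y Y_fin SB BS.
have [Cg Cg0 hms] := ms_order.
(* (2 C1)^-1 bounds one of the densities from below, C3^-1 the normalizer of the
   marginal posterior. *)
pose K := C3 * (2 * C1) + C3 ^+ 2.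
have K0 : 0 < K by rewrite addr_gt0 ?exprn_gt0// !mulr_gt0.
exists (Num.sqrt K * (L * Cg)); first by rewrite !mulr_gt0 ?sqrtr_gt0.
move=> h M h0 M0.
have MR0 : (0 : R) < M%:R by rewrite ltr0n.
pose k (z : Omega * borel X) := expR (- misfit Gamma_mhalf y (Gh h z)).
have mk : measurable_fun setT k.
  exact: (measurableT_comp
    (continuous_borel_measurable (lipschitz_continuous L0 lip)) (mGh h h0)).
have k01 z : 0 < k z <= 1.
  rewrite expR_gt0 -expR0 ler_expR oppr_le0 mulr_ge0 ?invr_ge0 ?sqr_ge0//.
have k0 z : 0 <= k z by apply: ltW; case/andP: (k01 z).
have k1 z : k z <= 1 by case/andP: (k01 z).
have ik (w : Omega) : mu0.-integrable setT (EFin \o (fun u => k (w, u))).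
  apply: (@bounded_integrable _ _ _ _ _ 1); first exact: measurableT_comp.
  by move=> u; rewrite ger0_norm.
pose D := (L * (Cg * h `^ s)) ^+ 2.
(* The exact likelihood is the constant around which the variance of
   exp(-Phi_h(u)) is bounded. *)
have gD : {ae mu0, forall u, \int[nu h]_z (k (z, u) - expR (- Phi u)) ^+ 2 <= D}.
  apply: filterS (hms h h0) => u hu.
  have gE : ((\int[nu h]_w (`|G u - Gh h (w, u)| ^+ 2)%:E) <= ((Cg * h `^ s) ^+ 2)%:E)%E.
    have I0 : (0 <= \int[nu h]_w (`|G u - Gh h (w, u)| ^+ 2)%:E)%E.
      by apply: integral_ge0 => w _; rewrite lee_fin sqr_ge0.
    rewrite -(poweR_half_sqr I0) EFin_expe lee_sqr ?poweR_ge0//.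
    by rewrite lee_fin mulr_ge0 ?powR_ge0// ltW.
  have mku : measurable_fun setT (fun z => k (z, u)) by exact: measurableT_comp.
  rewrite -lee_fin -EFin_Rintegral; last first.
    apply: (@bounded_integrable _ _ _ _ _ 1).
      by apply: measurable_funX; exact: measurable_funB.
    have e1 : expR (- Phi u) <= 1.
      by rewrite -expR0 ler_expR oppr_le0 mulr_ge0 ?invr_ge0 ?sqr_ge0.
    move=> z; rewrite normrX exprn_ile1// ler_norml.
    have := expR_ge0 (- Phi u); have := k0 (z, u); have := k1 (z, u); lra.
  rewrite /D exprMn EFinM.
  have mGG : measurable_fun setT (fun w => (`|G u - Gh h (w, u)| ^+ 2)%:E).
    apply/measurable_EFinP; apply: measurable_funX.
    apply: (@measurableT_comp _ _ _ _ _ _ 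
      (fun v : borel Y => `|G u - v|) _ (fun w => Gh h (w, u))).
      apply: (@continuous_borel_measurable _ _ (fun v : Y => `|G u - v|)).
      apply: (@lipschitz_continuous _ _ _ 1) => // v v'; rewrite mul1r.
      apply: le_trans (ler_dist_dist _ _) _.
      by rewrite opprB addrC addrA subrK distrC.
    exact: (measurableT_comp (mGh h h0) (pair2_measurable u)).
  apply: le_trans (_ : (\int[nu h]_w ((L ^+ 2)%:E * (`|G u - Gh h (w, u)| ^+ 2)%:E) <= _)%E).
    apply: le_integral_ge0 => w; first by rewrite lee_fin sqr_ge0.
    rewrite -EFinM lee_fin -exprMn -(real_normK (num_real (k (w, u) - _))).
    rewrite ler_sqr ?nnegrE// ?mulr_ge0// ?(ltW L0)// (distrC (G u)).
    exact: lip.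
  rewrite ge0_integralZl//; last by rewrite lee_fin sqr_ge0.
  by apply: lee_wpmul2l => //; rewrite lee_fin sqr_ge0.
have aE : \int[mu0]_u \int[nu h]_z k (z, u) = \int[nu h]_z \int[mu0]_u k (z, u).
  by rewrite (@Rintegral_fubini _ _ _ _ _ (nu h) mu0 k 1)// => z; rewrite k0 k1.
have aC3 : C3^-1 <= \int[mu0]_u \int[nu h]_z k (z, u).
  rewrite aE -[leLHS](Rintegral_cstT (nu h)); apply: ae_le_Rintegral.
  - exact: finite_measure_integrable_cst.
  - apply: (@bounded_integrable _ _ _ _ _ 1).
      exact: measurable_Rintegral_section.
    move=> z; rewrite ger0_norm ?Rintegral_ge0// -(Rintegral_cstT mu0 1).
    by apply: le_Rintegral => //; exact: finite_measure_integrable_cst.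
  - by apply: filterS (hiii h h0) => z /andP[].
have bE w : \int[mu0]_u (M%:R^-1 * \sum_(i < M) k (xi h M i w, u)) =
    normalizer_mc mu0 (fun i : 'I_M => Phih h (xi h M i w)).
  rewrite RintegralZl//; last first.
    exact: (@integrable_EFin_sum _ _ _ mu0 _
    (fun (i : 'I_M) u => k (xi h M i w, u))).
  by rewrite (@Rintegral_sum _ _ _ mu0 _
    (fun (i : 'I_M) u => k (xi h M i w, u))).
have main := @mean_sqr_hellinger_le R _ _ _ _ _ _ (P h M) (nu h) mu0 M (xi h M) k
  M0 (xi_iid h M h0 M0) mk k01 (fun u => expR (- Phi u)) C1 C3 C4 D
  (mu_m h) (mu_mM h M)
  C10 C30 C40.
have {main} : (\int[P h M]_w hellinger mu0 (mu_m h) (mu_mM h M w) ^+ 2 <=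
    (K * (M%:R^-1 * D))%:E)%E.
  apply: main => //.
  - apply: filterS (hi h M h0 M0) => w; congr (Order.min _ _ <= _)%E.
      apply: eq_integral => z _; congr Lnorm; apply/funext => u.
      by rewrite /k expRN invrK.
    congr Lnorm; apply/funext => u; congr EFin; congr (_ * _).
    by apply: eq_bigr => i _; rewrite /k expRN invrK.
  - by apply: filterS (hiv h M h0 M0) => w; rewrite bE => /andP[].
  - by move: (hm h h0); rewrite aE.
  - by move=> w; rewrite bE; exact: hmM.
have KD0 : 0 <= K * (M%:R^-1 * D).
  by apply: mulr_ge0; [exact: ltW|apply: mulr_ge0; [rewrite invr_ge0|exact: sqr_ge0]].
move=> hle; apply: (@le_trans _ _ ((K * (M%:R^-1 * D))%:E `^ (2^-1))%E).
  apply: gt0_ler_poweR => //.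
  - by rewrite in_itv/= leey andbT integral_ge0// => w _; rewrite sqre_ge0.
  - by rewrite in_itv/= leey andbT lee_fin.
rewrite poweR_EFin lee_fin powR12_sqrt//.
rewrite sqrtrM ?(ltW K0)// sqrtrM ?invr_ge0// sqrtrV// sqrtr_sqr ger0_norm; last first.
  by apply: mulr_ge0; [exact: ltW|apply: mulr_ge0; [exact: ltW|exact: powR_ge0]].
by rewrite le_eqVlt; apply/orP; left; apply/eqP; ring.
Qed.
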